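(* Let $r$ be a nonnegative integer. For every integer $n\geq 0$, we have $$B^{(c,r)}_n(x)=\sum_{k=0}^n x^k\,T_r(n+r,k+r).$$
   Context: For a nonnegative integer $r$, the extended $r$-central factorial numbers of the second kind $T_r(n+r,k+r)$ ($n\ge k\ge 0$) are defined by the formal power series identity $$\frac{1}{k!}e^{rt}\left(e^{t/2}-e^{-t/2}\right)^k=\sum_{n=k}^\infty T_r(n+r,k+r)\frac{t^n}{n!},\qquad k\ge 0.$$ The extended $r$-central Bell polynomials $B^{(c,r)}_n(x)$ are defined by the formal power series identity (in $t$) $$e^{rt}e^{x\left(e^{t/2}-e^{-t/2}\right)}=\sum_{n=0}^\infty B^{(c,r)}_n(x)\frac{t^n}{n!}.$$ *)

(* Defs.v *)
From HB Require Import structures.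
From mathcomp Require Import all_boot all_order all_algebra.

Set Implicit Arguments.
Unset Strict Implicit.
Unset Printing Implicit Defensive.

Import Order.TTheory GRing.Theory Num.Theory.
Local Open Scope ring_scope.

(* A formal power series in t is its coefficient sequence; two series are
   equal when they agree pointwise (=1). *)
Definition fps (A : Type) := nat -> A.

Section FormalPowerSeries.
Variable A : comUnitRingType.
Implicit Types f g : fps A.

Definition fps_one : fps A := fun n => (n == 0)%:R.

Definition fps_sub f g : fps A := fun n => f n - g n.

Definition fps_scale (c : A) f : fps A := fun n => c * f n.

Definition fps_mul f g : fps A := fun n => \sum_(i < n.+1) f i * g (n - i)%N.

Definition fps_exp f (k : nat) : fps A := iter k (fps_mul f) fps_one.

(* The series c t. *)
Definition fps_linear (c : A) : fps A := fun n => c *+ (n == 1%N).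

(* e^f = sum_k f^k / k! for f without constant term: then f^k only has terms
   of degree at least k, so the terms with k > n do not contribute to the
   coefficient of t^n. It is only used for such f, over rings in which every
   k! is invertible. *)
Definition fps_expe f : fps A :=
  fun n => \sum_(k < n.+1) (k`!%:R)^-1 * fps_exp f k n.

(* e^{t/2} - e^{-t/2} *)
Definition fps_central : fps A :=
  fps_sub (fps_expe (fps_linear (2%:R^-1))) (fps_expe (fps_linear (- 2%:R^-1))).

End FormalPowerSeries.

(* e^{rt} (e^{t/2} - e^{-t/2})^k / k! *)
Definition central_factorial_series (R : numFieldType) (r k : nat) : fps R :=
  fps_scale (k`!%:R)^-1
    (fps_mul (fps_expe (fps_linear r%:R)) (fps_exp (fps_central R) k)).

(* T_r(N, K), where N = n + r and K = k + r; it is meaningful only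
   for N, K >= r, so that the natural-number subtractions are exact. *)
Definition central_factorial2 (R : numFieldType) (r N K : nat) : R :=
  (N - r)`!%:R * central_factorial_series R r (K - r) (N - r)%N.

(* e^{rt} e^{x (e^{t/2} - e^{-t/2})}, with coefficients in R[x]. *)
Definition central_bell_series (R : numFieldType) (r : nat) : fps {poly R} :=
  fps_mul (fps_expe (fps_linear r%:R))
    (fps_expe (fps_scale 'X (fps_central {poly R}))).

Definition central_bell (R : numFieldType) (r n : nat) : {poly R} :=
  n`!%:R * central_bell_series R r n.

Lemma fact_natr_neq0 (R : numFieldType) n : n`!%:R != 0 :> R.
Proof. by rewrite pnatr_eq0 -lt0n fact_gt0. Qed.

Lemma fps_expe0 (A : comUnitRingType) (f : fps A) : fps_expe f 0%N = 1.
Proof. by rewrite /fps_expe big_ord1 fact0 invr1 mul1r. Qed.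

Lemma fps_exp_eq0 (A : comUnitRingType) (f : fps A) k n :
  f 0%N = 0 -> (n < k)%N -> fps_exp f k n = 0.
Proof.
move=> f0; elim: k n => // k IHk n ltnk; rewrite /fps_exp /= /fps_mul.
apply: big1 => -[[|i] /= lti] _; first by rewrite f0 mul0r.
rewrite [X in _ * X]IHk ?mulr0 //.
by case: n ltnk lti => // n ltnk _; rewrite subSS (leq_ltn_trans (leq_subr _ _)).
Qed.

Lemma fps_central0 (A : comUnitRingType) : fps_central A 0%N = 0.
Proof. by rewrite /fps_central /fps_sub !fps_expe0 subrr. Qed.

(* The defining identities:
   e^{rt} (e^{t/2} - e^{-t/2})^k / k! = sum_(n >= k) T_r(n+r, k+r) t^n / n!
   and e^{rt} e^{x (e^{t/2} - e^{-t/2})} = sum_(n >= 0) B_n(x) t^n / n!. *)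
Lemma central_factorial2_egf (R : numFieldType) (r k : nat) :
  central_factorial_series R r k =1
  fun n => if (k <= n)%N then central_factorial2 R r (n + r) (k + r) / n`!%:R
           else 0.
Proof.
move=> n; rewrite /central_factorial2 !addnK; case: leqP => [_|ltnk].
  by rewrite mulrAC divff ?mul1r ?fact_natr_neq0.
rewrite /central_factorial_series /fps_scale /fps_mul big1 ?mulr0 // => i _.
by rewrite fps_exp_eq0 ?mulr0 ?fps_central0 // (leq_ltn_trans (leq_subr _ _)).
Qed.

Lemma central_bell_egf (R : numFieldType) (r : nat) :
  central_bell_series R r =1 fun n => (n`!%:R)^-1 *: central_bell R r n.
Proof.
move=> n; rewrite /central_bell -polyC_natr mul_polyC scalerA.
by rewrite mulVf ?scale1r ?fact_natr_neq0.
Qed.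

(* Main.v *)
(** Expand [e^{x u}], with [u = e^{t/2} - e^{-t/2}], in powers of [x]: the
    coefficient of [x^k] in [e^{rt} e^{x u}] is [e^{rt} u^k / k!], the
    generating function of the numbers [T_r(n+r, k+r)]. *)
Require Import Defs.
From mathcomp Require Import all_boot all_order all_algebra.

Set Implicit Arguments.
Unset Strict Implicit.
Unset Printing Implicit Defensive.

Import Order.TTheory GRing.Theory Num.Theory.
Local Open Scope ring_scope.

(** Series are compared by [=1], which plain rewriting cannot use under [fps_mul] or [fps_expe];
    this congruence and the next two fill that role. *)
Lemma eq_fps_mul (A : comUnitRingType) (f f' g g' : fps A) :
  f =1 f' -> g =1 g' -> fps_mul f g =1 fps_mul f' g'.
Proof. by move=> ff' gg' n; apply: eq_bigr => i _; rewrite ff' gg'. Qed.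

Lemma eq_fps_exp (A : comUnitRingType) (f f' : fps A) k :
  f =1 f' -> fps_exp f k =1 fps_exp f' k.
Proof. by move=> ff'; elim: k => // k IHk; apply: eq_fps_mul. Qed.

Lemma eq_fps_expe (A : comUnitRingType) (f f' : fps A) :
  f =1 f' -> fps_expe f =1 fps_expe f'.
Proof. by move=> ff' n; apply: eq_bigr => k _; rewrite (eq_fps_exp k ff'). Qed.

Lemma fps_exp_scale (A : comUnitRingType) (c : A) (f : fps A) k :
  fps_exp (fps_scale c f) k =1 fps_scale (c ^+ k) (fps_exp f k).
Proof.
elim: k => [|k IHk] n; first by rewrite /fps_scale mul1r.
rewrite /fps_scale /fps_exp /= /fps_mul mulr_sumr; apply: eq_bigr => i _.
by rewrite [X in _ * X]IHk /fps_scale exprS mulrACA.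
Qed.

Section Morphism.
Variables (A B : comUnitRingType) (phi : {rmorphism A -> B}).

(** First step of a base change: with [phi := polyC], series over [{poly R}] with constant
    coefficients can be computed over [R]. *)
Lemma fps_mul_morph (f g : fps A) :
  fps_mul (phi \o f) (phi \o g) =1 phi \o fps_mul f g.
Proof.
by move=> n /=; rewrite rmorph_sum; apply: eq_bigr => i _; rewrite rmorphM.
Qed.

Lemma fps_exp_morph (f : fps A) k : fps_exp (phi \o f) k =1 phi \o fps_exp f k.
Proof.
elim: k => [|k IHk] n; first by rewrite /= /fps_one rmorph_nat.
by rewrite -[RHS]fps_mul_morph; apply: eq_fps_mul.
Qed.

Lemma fps_linear_morph (c : A) : fps_linear (phi c) =1 phi \o fps_linear c.
Proof. by move=> n; rewrite /= /fps_linear rmorphMn. Qed.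

End Morphism.

Section Polynomials.
Variable R : numFieldType.

Lemma polyC_natV m : (m%:R)^-1 = ((m%:R)^-1)%:P :> {poly R}.
Proof. by rewrite -polyCV polyC_natr. Qed.

(** Stated for [polyC] rather than any [phi]: the exponential contains the inverses of [k!], which
    [polyC] preserves by [polyC_natV]. *)
Lemma fps_expe_polyC (f : fps R) :
  fps_expe (polyC \o f) =1 polyC \o fps_expe f.
Proof.
move=> n; rewrite /= rmorph_sum; apply: eq_bigr => k _.
by rewrite fps_exp_morph rmorphM /= polyC_natV.
Qed.

Lemma fps_expe_linear_polyC (c : R) :
  fps_expe (fps_linear c%:P) =1 polyC \o fps_expe (fps_linear c).
Proof.
move=> n; rewrite -fps_expe_polyC.
by apply: eq_fps_expe; apply: fps_linear_morph.
Qed.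

Lemma fps_central_polyC : fps_central {poly R} =1 polyC \o fps_central R.
Proof.
move=> n; rewrite /= /fps_central /fps_sub polyC_natV -polyCN.
by rewrite !fps_expe_linear_polyC polyCB.
Qed.

(** The cutoff [m] may exceed [n] because [f] has no constant term, so [f^k] contributes nothing in
    degree [n] once [k > n]. This freedom gives all factors of a Cauchy product the same range of
    [k]. *)
Lemma fps_expe_scaleX (f : fps R) n m : f 0%N = 0 -> (n <= m)%N ->
  fps_expe (fps_scale 'X (polyC \o f)) n =
  \sum_(k < m.+1) ((k`!%:R)^-1 * fps_exp f k n) *: 'X^k.
Proof.
move=> f0 lenm.
rewrite /fps_expe (big_ord_widen m.+1 (fun k => (k`!%:R)^-1 *
  fps_exp (fps_scale 'X (polyC \o f)) k n)) // big_mkcond /=.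
apply: eq_bigr => k _; case: ltnP => [_|ltnk]; last first.
  by rewrite fps_exp_eq0 // mulr0 scale0r.
rewrite fps_exp_scale /fps_scale fps_exp_morph polyC_natV /=.
by rewrite -mul_polyC polyCM -mulrA ['X^k * _]mulrC.
Qed.

Lemma central_bell_seriesE (r n : nat) :
  central_bell_series R r n =
  \sum_(k < n.+1) central_factorial_series R r k n *: 'X^k.
Proof.
pose E := fps_expe (fps_linear (r%:R : R)).
(* The factor of index [n - i] would naturally stop at [k <= n - i]; padding it to [k <= n] makes
   the range independent of [i], so the two sums can be exchanged. *)
transitivity (\sum_(i < n.+1) \sum_(k < n.+1)
    (E i * ((k`!%:R)^-1 * fps_exp (fps_central R) k (n - i)%N)) *: 'X^k).
  apply: eq_bigr => i _; rewrite -polyC_natr fps_expe_linear_polyC /=.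
  rewrite (@eq_fps_expe _ _ (fps_scale 'X (polyC \o fps_central R))); last first.
    by move=> m; rewrite /fps_scale fps_central_polyC.
  rewrite (@fps_expe_scaleX _ _ n) ?fps_central0 ?leq_subr // mulr_sumr.
  by apply: eq_bigr => k _; rewrite mul_polyC scalerA.
(* For fixed [k], the sum over [i] is now a Cauchy product over [R], up to the position of the
   factor [1/k!]. *)
rewrite exchange_big; apply: eq_bigr => k _; rewrite -scaler_suml.
rewrite /central_factorial_series /fps_scale mulr_sumr; congr (_ *: _).
by apply: eq_bigr => i _; rewrite mulrCA.
Qed.

End Polynomials.

Theorem theorem2p5 (R : numFieldType) (r n : nat) :
  central_bell R r n =
  \sum_(0 <= k < n.+1) central_factorial2 R r (n + r) (k + r) *: 'X^k.
Proof.
rewrite big_mkord /central_bell central_bell_seriesE mulr_sumr.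
apply: eq_bigr => k _; rewrite /central_factorial2 !addnK.
by rewrite -polyC_natr mul_polyC scalerA.
Qed.
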